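(* Let $E$ be an Archimedean vector lattice and let $F$ be a Banach lattice with order continuous norm. Then the set $\mathcal{COA}_r(E,F)$ of all $C$-compact regular orthogonally additive operators from $E$ to $F$ is a projection band in the vector lattice $\mathcal{OA}_r(E,F)$ of all regular orthogonally additive operators from $E$ to $F$.
   Context: All vector lattices are Archimedean. Elements $x,y$ of a vector lattice $E$ are disjoint, $x\perp y$, if $|x|\wedge|y|=0$. An element $y\in E$ is a fragment of $x\in E$, written $y\sqsubseteq x$, if $y\perp(x-y)$; $\mathcal{F}_x$ denotes the set of all fragments of $x$. A (generally nonlinear) map $T:E\to X$ into a real vector space $X$ is an orthogonally additive operator if $T(x+y)=Tx+Ty$ for all disjoint $x,y\in E$. If $F$ is a vector lattice, an orthogonally additive operator $T:E\to F$ is positive if $Tx\ge 0$ for all $x\in E$ (not only for $x\geq 0$), and regular if $T=S_1-S_2$ for two positive orthogonally additive operators $S_1,S_2:E\to F$. $\mathcal{OA}_r(E,F)$ is the real vector space (pointwise operations) of all regular orthogonally additive operators, ordered by $S\le T$ iff $T-S$ is positive. When $F$ is Dedekind complete, $\mathcal{OA}_r(E,F)$ is known to be a Dedekind complete vector lattice. A Banach lattice has order continuous norm if $x_\alpha\downarrow 0$ implies $\|x_\alpha\|\downarrow 0$; such a Banach lattice is Dedekind complete. An orthogonally additive operator $T:E\to Y$ into a normed space $Y$ is $C$-compact if $T(\mathcal{F}_x)$ is relatively compact in $Y$ for every $x\in E$. *)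

(* Defs.v *)
From HB Require Import structures.
From mathcomp Require Import all_boot all_order all_algebra.
From mathcomp Require Import boolp classical_sets functions reals topology.
From mathcomp Require Import normedtype sequences.

Set Implicit Arguments.
Unset Strict Implicit.
Unset Printing Implicit Defensive.

Import Order.TTheory GRing.Theory Num.Theory.
Import numFieldNormedType.Exports.

Local Open Scope classical_set_scope.
Local Open Scope ring_scope.

Reserved Notation "x <=v y" (at level 70, no associativity).

(* The order is a field of the mixin rather than an [Order.Lattice] structure:
   Hierarchy-Builder rejects a join of the Order and the normed-module
   hierarchies that is not a numDomainType. *)
HB.mixin Record isVectorLattice (R : realType) E of GRing.Lmodule R E := {
  vle : E -> E -> Prop;
  vjoin : E -> E -> E;
  vmeet : E -> E -> E;
  vle_refl : forall x : E, vle x x;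
  vle_anti : forall x y : E, vle x y -> vle y x -> x = y;
  vle_trans : forall y x z : E, vle x y -> vle y z -> vle x z;
  vle_add2r : forall z x y : E, vle x y -> vle (x + z) (y + z);
  scalev_ge0 : forall (a : R) (x : E), 0 <= a -> vle 0 x -> vle 0 (a *: x);
  vjoin_lub : forall x y z : E, vle (vjoin x y) z <-> vle x z /\ vle y z;
  vmeet_glb : forall x y z : E, vle z (vmeet x y) <-> vle z x /\ vle z y }.

#[short(type="vectorLatticeType")]
HB.structure Definition VectorLattice (R : realType) :=
  { E of isVectorLattice R E & GRing.Lmodule R E }.

Arguments vle_anti {R s} [x y].
Arguments vle_trans {R s} [y x z].
Arguments vle_add2r {R s} z [x y].

Notation "x <=v y" := (vle x y) : ring_scope.

Definition vabs (R : realType) (E : vectorLatticeType R) (x : E) : E :=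
  vjoin x (- x).

HB.mixin Record hasLatticeNorm (R : realType) F
    of VectorLattice R F & NormedModule R F := {
  lattice_norm : forall x y : F, vabs x <=v vabs y -> `|x| <= `|y| }.

#[short(type="banachLatticeType")]
HB.structure Definition BanachLattice (R : realType) :=
  { F of hasLatticeNorm R F & VectorLattice R F & CompleteNormedModule R F }.

Section VectorLatticeNotions.
Variables (R : realType) (E : vectorLatticeType R).
Implicit Types (A B : set E) (x y s : E).

Definition is_ub A s := forall x, A x -> x <=v s.
Definition is_lb A s := forall x, A x -> s <=v x.
Definition is_lub A s := is_ub A s /\ (forall u, is_ub A u -> s <=v u).
Definition is_glb A s := is_lb A s /\ (forall u, is_lb A u -> u <=v s).

Definition archimedean :=
  forall x, 0 <=v x -> is_glb (range (fun n : nat => n.+1%:R^-1 *: x)) 0.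

Definition dedekind_complete :=
  forall A, A !=set0 -> (exists u, is_ub A u) -> exists s, is_lub A s.

Definition vdisjoint x y := vmeet (vabs x) (vabs y) = 0.

Definition fragments x : set E := [set y | vdisjoint y (x - y)].

Definition linear_subspace B :=
  [/\ B 0, forall x y, B x -> B y -> B (x + y) & forall (a : R) x, B x -> B (a *: x)].

Definition ideal B :=
  linear_subspace B /\ forall x y, vabs x <=v vabs y -> B y -> B x.

Definition band B :=
  ideal B /\ forall A s, A `<=` B -> is_lub A s -> B s.

Definition disjoint_complement B : set E :=
  [set x | forall y, B y -> vdisjoint x y].

Definition projection_band B :=
  [/\ band B,
      B `&` disjoint_complement B = [set 0] &
      forall x, exists y z, [/\ B y, disjoint_complement B z & x = y + z]].

End VectorLatticeNotions.

Definition directed (I : Type) (le : I -> I -> Prop) :=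
  [/\ inhabited I, forall i, le i i,
      forall j i k, le i j -> le j k -> le i k &
      forall i j, exists k, le i k /\ le j k].

Definition order_continuous_norm (R : realType) (F : banachLatticeType R) :=
  forall (I : Type) (le : I -> I -> Prop) (x : I -> F), directed le ->
    (forall i j, le i j -> x j <=v x i) -> is_glb (range x) 0 ->
    (forall i j, le i j -> `|x j| <= `|x i|) /\
    infimums (range (fun i => `|x i|)) 0.

Section VectorLatticeTheory.
Variables (R : realType) (E : vectorLatticeType R).
Implicit Types (x y z s t a b c p q : E).
Hint Resolve vle_refl : core.

Definition vpos x : E := vjoin x 0.

Lemma vle_add x y z t : x <=v y -> z <=v t -> x + z <=v y + t.
Proof.
move=> xy zt; apply: (@vle_trans _ _ (y + z)); first exact: vle_add2r.
by rewrite ![y + _]addrC; apply: vle_add2r.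
Qed.

Lemma vle_subl x y z : x - z <=v y <-> x <=v y + z.
Proof.
split=> h; first by have := vle_add2r z h; rewrite subrK.
by have := vle_add2r (- z) h; rewrite addrK.
Qed.

Lemma vle_subr x y z : x <=v y - z <-> x + z <=v y.
Proof.
split=> h; first by have := vle_add2r z h; rewrite subrK.
by have := vle_add2r (- z) h; rewrite addrK.
Qed.

Lemma subv_ge0 x y : 0 <=v y - x <-> x <=v y.
Proof. by rewrite vle_subr add0r. Qed.

Lemma vle_opp x y : x <=v y -> - y <=v - x.
Proof. by move=> h; apply/subv_ge0; rewrite opprK addrC; apply/subv_ge0. Qed.

Lemma addv_ge0 x y : 0 <=v x -> 0 <=v y -> 0 <=v x + y.
Proof. by move=> hx hy; rewrite -[0]addr0; apply: vle_add. Qed.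

Lemma vle_addl x y : 0 <=v y -> x <=v x + y.
Proof. by move=> hy; rewrite -{1}[x]addr0; apply: vle_add. Qed.

Lemma vjoinl x y : x <=v vjoin x y.
Proof. by have [] := (vjoin_lub x y (vjoin x y)).1 (vle_refl _). Qed.

Lemma vjoinr x y : y <=v vjoin x y.
Proof. by have [] := (vjoin_lub x y (vjoin x y)).1 (vle_refl _). Qed.

Lemma vmeetl x y : vmeet x y <=v x.
Proof. by have [] := (vmeet_glb x y (vmeet x y)).1 (vle_refl _). Qed.

Lemma vmeetr x y : vmeet x y <=v y.
Proof. by have [] := (vmeet_glb x y (vmeet x y)).1 (vle_refl _). Qed.

Lemma vjoin_le x y z : x <=v z -> y <=v z -> vjoin x y <=v z.
Proof. by move=> *; apply/vjoin_lub. Qed.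

Lemma vmeet_ge x y z : z <=v x -> z <=v y -> z <=v vmeet x y.
Proof. by move=> *; apply/vmeet_glb. Qed.

Hint Resolve vjoinl vjoinr vmeetl vmeetr : core.

Lemma vjoinC x y : vjoin x y = vjoin y x.
Proof. by apply: vle_anti; apply: vjoin_le. Qed.

Lemma vmeetC x y : vmeet x y = vmeet y x.
Proof. by apply: vle_anti; apply: vmeet_ge. Qed.

Lemma vmeet_mono x y z t : x <=v z -> y <=v t -> vmeet x y <=v vmeet z t.
Proof.
by move=> h k; apply: vmeet_ge; [apply: vle_trans h|apply: vle_trans k].
Qed.

Lemma vjoin_addr x y z : vjoin x y + z = vjoin (x + z) (y + z).
Proof.
apply: vle_anti; last by apply: vjoin_le; apply: vle_add2r.
by apply/vle_subr; apply: vjoin_le; apply/vle_subr.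
Qed.

Lemma oppv_join x y : - vjoin x y = vmeet (- x) (- y).
Proof.
apply: vle_anti; first by apply: vmeet_ge; apply: vle_opp.
rewrite -[vmeet _ _]opprK; apply: vle_opp; apply: vjoin_le.
  by rewrite -{1}[x]opprK; apply: vle_opp.
by rewrite -{1}[y]opprK; apply: vle_opp.
Qed.

Lemma vjoin_subl x y z : z - vmeet x y = vjoin (z - x) (z - y).
Proof.
rewrite -[x in LHS]opprK -[y in LHS]opprK -oppv_join opprK addrC vjoin_addr.
by rewrite ![- _ + z]addrC.
Qed.

Lemma vjoinDmeet x y : x + y = vjoin x y + vmeet x y.
Proof.
apply/eqP; rewrite -subr_eq vjoin_subl; apply/eqP.
by rewrite vjoinC addrK [x + y]addrC addrK.
Qed.

Lemma vabs_ge0 x : 0 <=v vabs x.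
Proof.
have h : 0 <=v vabs x + vabs x.
  by rewrite -[0](subrr x); apply: vle_add; [exact: vjoinl|exact: vjoinr].
have : 0 <=v (2^-1 : R) *: (vabs x + vabs x).
  by apply: scalev_ge0; rewrite ?invr_ge0 ?ler0n.
by rewrite -mulr2n -[vabs x *+ 2]scaler_nat scalerA mulVf ?pnatr_eq0// scale1r.
Qed.

Hint Resolve vabs_ge0 : core.

Lemma vle_abs x : x <=v vabs x. Proof. exact: vjoinl. Qed.

Lemma vleN_abs x : - x <=v vabs x. Proof. exact: vjoinr. Qed.

Lemma vabsN x : vabs (- x) = vabs x.
Proof. by rewrite /vabs opprK vjoinC. Qed.

Lemma vabs_le x y : x <=v y -> - x <=v y -> vabs x <=v y.
Proof. exact: vjoin_le. Qed.

Lemma vabs_pos x : 0 <=v x -> vabs x = x.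
Proof.
move=> hx; apply: vle_anti; last exact: vle_abs.
apply: vabs_le => //; apply: (@vle_trans _ _ 0) => //.
by rewrite -[0]oppr0; apply: vle_opp.
Qed.

Lemma vabs0 : vabs (0 : E) = 0. Proof. exact: vabs_pos. Qed.

Lemma vabs_add x y : vabs (x + y) <=v vabs x + vabs y.
Proof.
apply: vabs_le; first by apply: vle_add; apply: vle_abs.
by rewrite opprD; apply: vle_add; apply: vleN_abs.
Qed.

Lemma vabs_sub_le s t : 0 <=v s -> 0 <=v t -> vabs (s - t) <=v s + t.
Proof.
by move=> hs ht; apply: vle_trans (vabs_add _ _) _; rewrite vabsN !vabs_pos.
Qed.

Lemma vpos_ge0 x : 0 <=v vpos x. Proof. exact: vjoinr. Qed.

Lemma vpos_ge x : x <=v vpos x. Proof. exact: vjoinl. Qed.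

Lemma vpos_le x y : x <=v y -> 0 <=v y -> vpos x <=v y.
Proof. exact: vjoin_le. Qed.

Hint Resolve vpos_ge0 vpos_ge : core.

Lemma vpos_abs x : vpos x <=v vabs x.
Proof. by apply: vpos_le => //; apply: vle_abs. Qed.

Lemma vposN_abs x : vpos (- x) <=v vabs x.
Proof. by rewrite -vabsN; apply: vpos_abs. Qed.

Lemma vposE x : x = vpos x - vpos (- x).
Proof.
apply/eqP; rewrite eq_sym subr_eq addrC /vpos vjoin_addr addNr add0r.
by rewrite vjoinC.
Qed.

Lemma vmeet_ge0 x y : 0 <=v x -> 0 <=v y -> 0 <=v vmeet x y.
Proof. exact: vmeet_ge. Qed.

Lemma vmeet_pos_neg x : vmeet (vpos x) (vpos (- x)) = 0.
Proof.
apply: vle_anti; last exact: vmeet_ge0.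
set m := vmeet _ _; suff : vpos x <=v vpos x - m.
  by move/vle_subr/(vle_add2r (- vpos x)); rewrite addrAC subrr add0r.
have eN : vpos (- x) = vpos x - x by rewrite {3}[x]vposE opprB addrC subrK.
apply: vpos_le; apply/vle_subr; last by rewrite add0r; apply: vmeetl.
rewrite addrC; apply/vle_subr; rewrite -eN; exact: vmeetr.
Qed.

Lemma vpos_disjoint s t : vmeet s t = 0 -> vpos (s - t) = s.
Proof.
move=> st0; rewrite -[RHS]subr0 -st0 vjoin_subl subrr /vpos.
by rewrite vjoinC.
Qed.

Lemma vmeet0_mono s t s' t' : 0 <=v s' -> 0 <=v t' -> s' <=v s -> t' <=v t ->
  vmeet s t = 0 -> vmeet s' t' = 0.
Proof.
move=> s'0 t'0 ss' tt' st0; apply: vle_anti; last exact: vmeet_ge0.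
by rewrite -st0; apply: vmeet_mono.
Qed.

Lemma vmeet_addr_le c a b : 0 <=v a -> 0 <=v b -> 0 <=v c ->
  vmeet c (a + b) <=v vmeet c a + vmeet c b.
Proof.
move=> a0 b0 c0; set d := vmeet c (a + b).
rewrite addrC; apply/vle_subl; apply: vmeet_ge.
  apply/vle_subl; apply: (@vle_trans _ _ c); first exact: vmeetl.
  by apply: vle_addl; apply: vmeet_ge0.
apply/vle_subl; rewrite addrC; apply/vle_subl; apply: vmeet_ge; apply/vle_subl.
  by apply: (@vle_trans _ _ c); [apply: vmeetl|apply: vle_addl].
exact: vmeetr.
Qed.

Lemma vmeet0_add a b c : 0 <=v a -> 0 <=v b -> 0 <=v c ->
  vmeet a c = 0 -> vmeet b c = 0 -> vmeet (a + b) c = 0.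
Proof.
move=> a0 b0 c0 ac bc; apply: vle_anti.
  rewrite vmeetC; apply: vle_trans (vmeet_addr_le _ _ _) _ => //.
  by rewrite ![vmeet c _]vmeetC ac bc addr0.
by apply: vmeet_ge0 => //; apply: addv_ge0.
Qed.

Lemma vdisjointC x y : vdisjoint x y -> vdisjoint y x.
Proof. by rewrite /vdisjoint vmeetC. Qed.

Lemma vdisjoint_mono x y x' y' : vabs x' <=v vabs x -> vabs y' <=v vabs y ->
  vdisjoint x y -> vdisjoint x' y'.
Proof. by move=> hx hy; apply: vmeet0_mono. Qed.

Lemma vdisjoint0 x : vdisjoint x 0.
Proof. by rewrite /vdisjoint vabs0 vmeetC; apply: vle_anti => //; apply: vmeet_ge. Qed.

Lemma vdisjointD x y z : vdisjoint x z -> vdisjoint y z -> vdisjoint (x + y) z.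
Proof.
move=> xz yz; have := vmeet0_add (vabs_ge0 x) (vabs_ge0 y) (vabs_ge0 z) xz yz.
by apply: vmeet0_mono => //; apply: vabs_add.
Qed.

Lemma fragments0 x : fragments x 0.
Proof. by apply/vdisjointC/vdisjoint0. Qed.

Lemma fragments_self x : fragments x x.
Proof. by rewrite /fragments /= subrr; apply: vdisjoint0. Qed.

Lemma vmeet_split p q a b : 0 <=v p -> 0 <=v q -> 0 <=v a -> 0 <=v b ->
  p + q = a + b -> vmeet a b = 0 -> p = vmeet p a + vmeet p b.
Proof.
move=> p0 q0 a0 b0 e ab; apply: vle_anti.
  apply: vle_trans (vmeet_addr_le _ _ _) => //.
  by apply: vmeet_ge => //; rewrite -e; apply: vle_addl.
rewrite vjoinDmeet (_ : vmeet (vmeet _ _) _ = 0) ?addr0; first exact: vjoin_le.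
by apply: vmeet0_mono ab => //; apply: vmeet_ge0.
Qed.

Lemma vpos_add_disjoint x y : vdisjoint x y -> vpos (x + y) = vpos x + vpos y.
Proof.
move=> xy; rewrite {1}[x]vposE {1}[y]vposE addrACA -opprD.
have h u v : vdisjoint u v -> vmeet (vpos u) (vpos (- v)) = 0.
  by apply: vmeet0_mono => //; [apply: vpos_abs|apply: vposN_abs].
apply: vpos_disjoint; apply: vmeet0_add => //; try exact: addv_ge0.
  rewrite vmeetC; apply: vmeet0_add => //; rewrite vmeetC.
    exact: vmeet_pos_neg.
  exact: h.
rewrite vmeetC; apply: vmeet0_add => //; rewrite vmeetC.
  exact/h/vdisjointC.
exact: vmeet_pos_neg.
Qed.

Lemma vdisjointN x y : vdisjoint x y -> vdisjoint (- x) (- y).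
Proof. by rewrite /vdisjoint !vabsN. Qed.

Lemma fragments_add x y z : vdisjoint x y -> fragments (x + y) z ->
  exists z1 z2, [/\ fragments x z1, fragments y z2 & z = z1 + z2].
Proof.
move=> xy; rewrite /fragments /=; set w := x + y - z => zw.
have zwE : z + w = x + y by rewrite /w addrC subrK.
have part u v a b : vdisjoint u v -> vdisjoint a b -> u + v = a + b ->
    [/\ vpos u = vmeet (vpos u) (vpos a) + vmeet (vpos u) (vpos b) &
        vpos a = vmeet (vpos u) (vpos a) + vmeet (vpos v) (vpos a)].
  move=> uv ab e.
  have e' : vpos u + vpos v = vpos a + vpos b.
    by rewrite -!vpos_add_disjoint// e.
  have m0 s t : vdisjoint s t -> vmeet (vpos s) (vpos t) = 0.
    by apply: vmeet0_mono => //; apply: vpos_abs.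
  split; first by apply: (vmeet_split (q := vpos v)) => //; apply: m0.
  rewrite ![vmeet _ (vpos a)]vmeetC.
  by apply: (vmeet_split (q := vpos b)) => //; apply: m0.
have zwN : - z + - w = - x + - y by rewrite -!opprD zwE.
have half u v a b : vdisjoint u v -> vdisjoint a b -> u + v = a + b ->
    let c t := vmeet (vpos t) (vpos a) - vmeet (vpos (- t)) (vpos (- a)) in
    vdisjoint (c u) (a - c u).
  move=> uv ab e c; have [_ e1] := part _ _ _ _ uv ab e.
  have eN : - u + - v = - a + - b by rewrite -!opprD e.
  have [_ e2] := part _ _ _ _ (vdisjointN uv) (vdisjointN ab) eN.
  have -> : a - c u = c v.
    by rewrite {1}[a]vposE {1}e1 {1}e2 [X in X - _ - _]addrC
               [X in _ - X - _]addrC opprD addrACA addrK.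
  have cle t : vabs (c t) <=v vabs t.
    apply: vle_trans (vabs_sub_le _ _) _; try exact: vmeet_ge0.
    have -> : vabs t = vpos t + vpos (- t).
      rewrite vjoinDmeet vmeet_pos_neg addr0.
      apply: vle_anti; last first.
        by apply: vjoin_le; [apply: vpos_abs|apply: vposN_abs].
      by apply: vabs_le; [apply: vle_trans (vjoinl _ _)|apply: vle_trans (vjoinr _ _)].
    by apply: vle_add; apply: vmeetl.
  by apply: vdisjoint_mono uv; apply: cle.
have yx := vdisjointC xy.
exists (vmeet (vpos z) (vpos x) - vmeet (vpos (- z)) (vpos (- x))).
exists (vmeet (vpos z) (vpos y) - vmeet (vpos (- z)) (vpos (- y))).
split; [exact: half zw xy zwE|apply: half zw yx _; by rewrite zwE addrC|].
have [e1 _] := part _ _ _ _ zw xy zwE.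
have [e2 _] := part _ _ _ _ (vdisjointN zw) (vdisjointN xy) zwN.
by rewrite addrACA -opprD -e1 -e2 -vposE.
Qed.

Lemma fragments_abs x y : fragments x y -> vabs y <=v vabs x.
Proof.
rewrite /fragments /= => yx.
have e : x = y + (x - y) by rewrite addrC subrK.
have ep := vpos_add_disjoint yx; have en := vpos_add_disjoint (vdisjointN yx).
rewrite -opprD -e in en; rewrite -e in ep.
apply: vabs_le.
  apply: vle_trans (vpos_ge _) _; apply: vle_trans (vpos_abs _).
  by rewrite ep; apply: vle_addl.
apply: vle_trans (vpos_ge _) _; apply: vle_trans (vposN_abs _).
by rewrite en; apply: vle_addl.
Qed.

Lemma fragmentsC x y : fragments x y -> fragments x (x - y).
Proof. by rewrite /fragments /= subKr; apply: vdisjointC. Qed.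

Lemma fragmentsD x y x1 y1 : vdisjoint x y -> fragments x x1 -> fragments y y1 ->
  vdisjoint x1 y1 /\ fragments (x + y) (x1 + y1).
Proof.
move=> xy fx fy.
have d u v : fragments x u -> fragments y v -> vdisjoint u v.
  by move=> hu hv; apply: vdisjoint_mono xy; apply: fragments_abs.
split; first exact: d.
rewrite /fragments /= opprD addrACA.
have dl u : vdisjoint x1 u -> vdisjoint y1 u -> vdisjoint u (x1 + y1).
  by move=> *; apply/vdisjointC/vdisjointD.
apply/vdisjointC; apply: vdisjointD.
  by apply: dl; [exact: fx|apply/vdisjointC/d => //; apply: fragmentsC].
by apply: dl; [apply: d => //; apply: fragmentsC|exact: fy].
Qed.

End VectorLatticeTheory.

Section BanachLatticeTheory.
Variables (R : realType) (F : banachLatticeType R).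
Implicit Types (x y z : F).

Lemma norm_le_pos x y : 0 <=v x -> x <=v y -> `|x| <= `|y|.
Proof.
move=> x0 xy; apply: lattice_norm; rewrite !vabs_pos//.
exact: vle_trans xy.
Qed.

Lemma norm_pos_le x y : x <=v y -> `|vpos x| <= `|y|.
Proof.
move=> xy; apply: lattice_norm; rewrite [X in X <=v _]vabs_pos//; last exact: vpos_ge0.
by apply: vpos_le; [apply: vle_trans xy (vle_abs _)|apply: vabs_ge0].
Qed.

Lemma vle_norm_pos x y : (forall e : R, 0 < e -> `|vpos (x - y)| <= e) -> x <=v y.
Proof.
move=> h; have : vpos (x - y) = 0.
  apply/eqP; rewrite -normr_le0; apply/ler_addgt0Pl => e e0.
  by rewrite addr0; apply: h.
have := vpos_ge (x - y) => /[swap] ->.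
by move/vle_subl; rewrite add0r.
Qed.

Lemma banach_arch x y : 0 <=v x -> (forall n : nat, x *+ n <=v y) -> x = 0.
Proof.
move=> x0 h; apply/eqP; rewrite -normr_le0 leNgt; apply/negP => nx.
have hn n : `|x| *+ n <= `|y|.
  by rewrite -normrMn; apply: norm_le_pos => //; elim: n => [|n ih];
    rewrite ?mulr0n ?mulrS //; [apply: vle_refl|apply: addv_ge0].
have := hn (Num.truncn (`|y| / `|x|)).+1.
rewrite leNgt => /negP; apply.
rewrite -mulr_natl -ltr_pdivrMr//.
exact: truncnS_gt.
Qed.

Lemma order_continuous_dedekind : order_continuous_norm F -> dedekind_complete F.
Proof.
move=> oc A [a0 Aa0] [u0 uA].
pose U := [set v : F | is_ub A v].
pose L := [set l : F | is_lb U l].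
pose I := ({v | U v} * {l | L l})%type.
pose le (i j : I) := sval j.1 <=v sval i.1 /\ sval i.2 <=v sval j.2.
pose x (i : I) : F := sval i.1 - sval i.2.
have AL : A `<=` L by move=> a Aa v Uv; apply: Uv.
have dir : directed le.
  split.
  - by split; exact: (exist U u0 uA, exist L a0 (AL _ Aa0)).
  - by move=> i; split; apply: vle_refl.
  - move=> j i k [h1 h2] [h3 h4].
    by split; [apply: vle_trans h3 h1|apply: vle_trans h2 h4].
  move=> [[v Uv] [l Ll]] [[v' Uv'] [l' Ll']].
  have Um : U (vmeet v v').
    by move=> a Aa; apply: vmeet_ge; [apply: Uv|apply: Uv'].
  have Lm : L (vjoin l l').
    by move=> w Uw; apply: vjoin_le; [apply: Ll|apply: Ll'].
  exists (exist U _ Um, exist L _ Lm); split; split => /=;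
    by [apply: vmeetl|apply: vmeetr|apply: vjoinl|apply: vjoinr].
have mono i j : le i j -> x j <=v x i.
  by case=> h1 h2; apply: vle_add => //; apply: vle_opp.
have glb0 : is_glb (range x) 0.
  split=> [_ [[[v Uv] [l Ll]] _ <-]|w hw].
    by apply/subv_ge0/Ll.
  apply: vle_trans (vpos_ge w) _; set p := vpos w.
  have pp : 0 <=v p := vpos_ge0 w.
  have hp v l : U v -> L l -> p <=v v - l.
    move=> Uv Ll; apply: vpos_le; last by apply/subv_ge0/Ll.
    by apply: hw; exists (exist U v Uv, exist L l Ll).
  have Un n : U (u0 - p *+ n).
    elim: n => [|n ih]; first by rewrite mulr0n subr0.
    move=> a Aa; rewrite mulrSr opprD addrA; apply: (vle_subr _ _ _).2.
    rewrite [a + p]addrC; apply: (vle_subr _ _ _).1.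
    by apply: hp => //; exact: AL.
  have -> : p = 0; last exact: vle_refl.
  apply: (@banach_arch _ (u0 - a0)) => // n.
  apply: (vle_subr _ _ _).2; rewrite addrC.
  by apply: (vle_subr _ _ _).1; apply: Un.
have [_ [_ inf0]] := oc I le x dir mono glb0.
have small (e : R) : 0 < e -> exists i, `|x i| < e.
  move=> e0; apply: contrapT => hN.
  suff : e <= 0 by rewrite leNgt e0.
  apply: inf0 => _ [i _ <-]; rewrite leNgt; apply/negP => hi.
  by apply: hN; exists i.
have [i hi] : {i : nat -> I & forall n, `|x (i n)| < n.+1%:R^-1}.
  by apply: (@choice _ _ (fun n j => `|x j| < n.+1%:R^-1)) => n;
     apply: small; rewrite invr_gt0.
pose l n := sval (i n).2.
have lU n v : U v -> l n <=v v by move=> Uv; apply: (svalP (i n).2).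
have vU n : U (sval (i n).1) by exact: (svalP (i n).1).
have ll n m : `|l n - l m| <= n.+1%:R^-1 + m.+1%:R^-1.
  have -> : n.+1%:R^-1 + m.+1%:R^-1 = m.+1%:R^-1 + n.+1%:R^-1 :> R by rewrite addrC.
  have xp k : 0 <=v x (i k) by apply/subv_ge0/(svalP (i k).2).
  apply: (@le_trans _ _ (`|x (i m) + x (i n)|)); last first.
    apply: le_trans (ler_normD _ _) _; apply: lerD; exact/ltW.
  apply: lattice_norm; rewrite [vabs (x _ + _)]vabs_pos; last exact: addv_ge0.
  apply: vabs_le.
    apply: (@vle_trans _ _ (x (i m))); last exact: vle_addl.
    by apply: vle_add2r; apply: lU.
  rewrite opprB addrC; apply: (@vle_trans _ _ (x (i n))); last first.
    by rewrite addrC; apply: vle_addl.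
  by rewrite addrC; apply: vle_add2r; apply: lU.
have cl : cvgn l.
  apply/cauchy_cvgP/cauchy_exP => e e0.
  have [N hN] : exists N : nat, N.+1%:R^-1 < e / 2.
    exists (Num.truncn (e / 2)^-1).
    rewrite invf_plt ?posrE ?ltr0n ?divr_gt0//; exact: truncnS_gt.
  exists (l N); exists N => // n /= Nn.
  rewrite -ball_normE /=; apply: le_lt_trans (ll _ _) _.
  rewrite [e]splitr; apply: ltrD => //; apply: le_lt_trans hN.
  by rewrite lef_pV2 ?posrE ?ltr0n// ler_nat.
pose s := limn l.
have near e : 0 < e -> exists n, `|l n - s| < e /\ n.+1%:R^-1 < e.
  move=> e0; have /cvgrPdist_lt /(_ e e0) [N _ hN] : l @ \oo --> s by [].
  pose M := Num.truncn e^-1; exists (maxn N M); split.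
    by rewrite distrC; apply: hN; rewrite /= leq_maxl.
  rewrite invf_plt ?posrE ?ltr0n//.
  apply: (@lt_le_trans _ _ M.+1%:R); first exact: truncnS_gt.
  by rewrite ler_nat ltnS leq_maxr.
exists s; split=> [a Aa|v Uv]; apply: vle_norm_pos => e e0.
  have e2 : 0 < e / 2 by rewrite divr_gt0.
  have [n [h1 h2]] := near _ e2.
  apply: (@le_trans _ _ `|vabs (x (i n)) + vabs (l n - s)|).
    apply: norm_pos_le.
    rewrite -(subrK (l n) a) -addrA; apply: vle_add; last exact: vle_abs.
    apply: vle_trans (vle_abs _); apply: vle_add2r; exact: vU.
  apply: le_trans (ler_normD _ _) _; rewrite [e]splitr.
  have nn y : `|vabs y| <= `|y|.
    by apply: lattice_norm; rewrite [vabs (vabs y)]vabs_pos; [apply: vle_refl|apply: vabs_ge0].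
  apply: lerD; apply: le_trans (nn _) _; apply: ltW => //.
  exact: lt_trans (hi n) h2.
have [n [h1 _]] := near _ e0.
apply: le_trans (ltW h1).
by rewrite distrC; apply: norm_pos_le; apply: vle_add; [apply: vle_refl|apply/vle_opp/lU].
Qed.

End BanachLatticeTheory.

Definition orthogonally_additive (R : realType) (E : vectorLatticeType R)
    (X : lmodType R) (T : E -> X) :=
  forall x y, vdisjoint x y -> T (x + y) = T x + T y.

Definition C_compact (R : realType) (E : vectorLatticeType R)
    (Y : normedModType R) (T : E -> Y) :=
  forall x, precompact (T @` fragments x).

Section RegularOperators.
Variables (R : realType) (E F : vectorLatticeType R).

Definition positive_oao (T : E -> F) :=
  orthogonally_additive T /\ forall x, 0 <=v T x.

Definition regular_oao (T : E -> F) :=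
  exists S1 S2 : E -> F, [/\ positive_oao S1, positive_oao S2 & T = S1 - S2].

Definition regular_oao_pred : {pred E -> F} := [pred T | `[< regular_oao T >]].

Lemma orthogonally_additive0 (T : E -> F) : orthogonally_additive T -> T 0 = 0.
Proof.
move=> /(_ 0 0 (vdisjoint0 0)); rewrite addr0 => h.
by apply: (addrI (T 0)); rewrite -h addr0.
Qed.

Lemma positive_oao0 : positive_oao (0 : E -> F).
Proof.
by split=> [x y _|x]; [exact: esym (addr0 _)|exact: vle_refl].
Qed.

Lemma positive_oaoD (S T : E -> F) :
  positive_oao S -> positive_oao T -> positive_oao (S + T).
Proof.
move=> [aS pS] [aT pT]; split=> [x y xy|x]; last exact: addv_ge0.
by rewrite !fctE aS// aT// addrACA.
Qed.

Lemma positive_oaoZ (a : R) (T : E -> F) :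
  0 <= a -> positive_oao T -> positive_oao (a *: T).
Proof.
move=> a0 [aT pT]; split=> [x y xy|x]; last exact: scalev_ge0.
by rewrite !fctE aT// scalerDr.
Qed.

Lemma regular_oaoD (S T : E -> F) :
  regular_oao S -> regular_oao T -> regular_oao (S + T).
Proof.
move=> [S1 [S2 [p1 p2 ->]]] [T1 [T2 [q1 q2 ->]]].
exists (S1 + T1), (S2 + T2); split; [exact: positive_oaoD..|].
by rewrite opprD addrACA.
Qed.

Lemma regular_oaoZ (a : R) (T : E -> F) : regular_oao T -> regular_oao (a *: T).
Proof.
move=> [S1 [S2 [p1 p2 ->]]]; have [a0|a0] := lerP 0 a.
  by exists (a *: S1), (a *: S2); split; [exact: positive_oaoZ..|rewrite scalerBr].
exists (- a *: S2), (- a *: S1); split; try by apply: positive_oaoZ; rewrite // oppr_ge0 ltW.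
by rewrite scalerBr !scaleNr opprK addrC.
Qed.

Lemma positive_regular (T : E -> F) : positive_oao T -> regular_oao T.
Proof.
by move=> pT; exists T, 0; split; [|exact: positive_oao0|rewrite subr0].
Qed.

Lemma regular_oao_submod : GRing.submod_closed regular_oao_pred.
Proof.
split; first by apply/asboolP/positive_regular/positive_oao0.
move=> a S T /asboolP hS /asboolP hT; apply/asboolP.
by apply: regular_oaoD => //; apply: regular_oaoZ.
Qed.

HB.instance Definition _ :=
  GRing.isSubmodClosed.Build R (E -> F) regular_oao_pred regular_oao_submod.

(* The space of regular operators. The Dedekind completeness of F is a
   parameter because the lattice structure declared below depends on it. *)
Record OAr (dc : dedekind_complete F) :=
  MkOAr { OAr_fun :> E -> F; _ : OAr_fun \in regular_oao_pred }.

Section OArStructure.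
Variable dc : dedekind_complete F.
Notation OA := (OAr dc).

HB.instance Definition _ := [isSub for @OAr_fun dc].
HB.instance Definition _ := [Choice of OA by <:].
HB.instance Definition _ := [SubChoice_isSubLmodule of OA by <:].
Implicit Types (S T U : OA).

Lemma OAr_regular T : regular_oao T.
Proof. by case: T => T /= /asboolP. Qed.

Lemma OAr_additive T : orthogonally_additive T.
Proof.
have [S1 [S2 [[a1 _] [a2 _] ->]]] := OAr_regular T.
by move=> x y xy; rewrite !fctE a1// a2// opprD addrACA.
Qed.

Lemma OArP S T : (forall x, S x = T x) -> S = T.
Proof. by move=> h; apply/val_inj/funext. Qed.

Definition OAr_le S T := positive_oao (T - S : OA).

Lemma OAr_leP S T : OAr_le S T <-> forall x, S x <=v T x.
Proof.
split=> [[_ h] x|h]; first exact/subv_ge0/h.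
by split=> [|x]; [exact: OAr_additive|exact: (subv_ge0 (S x) (T x)).2].
Qed.

Definition pos_part_set (T : E -> F) x : set F := T @` fragments x.

Lemma pos_part_lub T x : is_lub (pos_part_set T x) (xget 0 (is_lub (pos_part_set T x))).
Proof.
apply: xgetPex; apply: dc; first by exists (T x); exists x => //; exact: fragments_self.
have [S1 [S2 [[a1 p1] [a2 p2] e]]] := OAr_regular T.
exists (S1 x) => _ [y xy <-]; rewrite e fctE.
apply: (@vle_trans _ _ (S1 y)).
  by apply/vle_subl; apply: vle_addl.
have -> : x = y + (x - y) by rewrite addrC subrK.
by rewrite a1//; exact: vle_addl.
Qed.

Definition pos_part_fun T x : F := xget 0 (is_lub (pos_part_set T x)).

Lemma pos_part_ub T x y : fragments x y -> T y <=v pos_part_fun T x.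
Proof. by move=> xy; apply: (pos_part_lub T x).1; exists y. Qed.

Lemma pos_part_least T x u : (forall y, fragments x y -> T y <=v u) ->
  pos_part_fun T x <=v u.
Proof. by move=> h; apply: (pos_part_lub T x).2 => _ [y xy <-]; apply: h. Qed.

Lemma pos_part_positive T : positive_oao (pos_part_fun T).
Proof.
split=> [x y xy|x]; last first.
  rewrite -(orthogonally_additive0 (OAr_additive T)); apply: pos_part_ub.
  exact: fragments0.
apply: vle_anti.
  apply: pos_part_least => z /(fragments_add xy) [z1 [z2 [f1 f2 ->]]].
  have [d _] := fragmentsD xy f1 f2.
  by rewrite OAr_additive//; apply: vle_add; apply: pos_part_ub.
rewrite addrC; apply: (vle_subr _ _ _).1; apply: pos_part_least => z2 f2.
apply: (vle_subr _ _ _).2; rewrite addrC; apply: (vle_subr _ _ _).1.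
apply: pos_part_least => z1 f1; apply: (vle_subr _ _ _).2.
have [d f] := fragmentsD xy f1 f2.
by rewrite -OAr_additive//; apply: pos_part_ub.
Qed.

Definition pos_part T : OA :=
  MkOAr dc (asboolT (positive_regular (pos_part_positive T))).

Definition OAr_join S T : OA := T + pos_part (S - T).
Definition OAr_meet S T : OA := - OAr_join (- S) (- T).

Lemma OAr_le_refl S : OAr_le S S.
Proof. by apply/OAr_leP => x; exact: vle_refl. Qed.

Lemma OAr_le_anti S T : OAr_le S T -> OAr_le T S -> S = T.
Proof. by move=> /OAr_leP h /OAr_leP k; apply: OArP => x; apply: vle_anti. Qed.

Lemma OAr_le_trans T S U : OAr_le S T -> OAr_le T U -> OAr_le S U.
Proof.
by move=> /OAr_leP h /OAr_leP k; apply/OAr_leP => x; apply: vle_trans (h x) (k x).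
Qed.

Lemma OAr_le_add2r U S T : OAr_le S T -> OAr_le (S + U) (T + U).
Proof. by move=> /OAr_leP h; apply/OAr_leP => x; exact: vle_add2r (h x). Qed.

Lemma OAr_scale_ge0 (a : R) T : 0 <= a -> OAr_le 0 T -> OAr_le 0 (a *: T).
Proof. by move=> a0 /OAr_leP h; apply/OAr_leP => x; exact: scalev_ge0 a0 (h x). Qed.

Lemma OAr_join_lub S T U : OAr_le (OAr_join S T) U <-> OAr_le S U /\ OAr_le T U.
Proof.
have SJ : OAr_le S (OAr_join S T).
  apply/OAr_leP => x; have := pos_part_ub (S - T) (fragments_self x).
  by move/vle_subl; rewrite addrC.
have TJ : OAr_le T (OAr_join S T).
  by apply/OAr_leP => x; apply: vle_addl; apply: (pos_part_positive _).2.
split=> [h|[SU TU]]; first by split; apply: OAr_le_trans h.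
apply/OAr_leP => x; rewrite [OAr_join S T x]addrC; apply: (vle_subr _ _ _).1.
apply: pos_part_least => y xy; have [aTU pTU] := TU.
have e : x = y + (x - y) by rewrite addrC subrK.
apply: (@vle_trans _ _ ((U - T) y)).
  by apply: vle_add2r; have /OAr_leP := SU; apply.
have -> : U x - T x = (U - T : OA) x by [].
by rewrite {1}e aTU//; apply: vle_addl.
Qed.

Lemma OAr_leN S T : OAr_le S T <-> OAr_le (- T) (- S).
Proof. by rewrite /OAr_le opprK addrC. Qed.

Lemma OAr_meet_glb S T U : OAr_le U (OAr_meet S T) <-> OAr_le U S /\ OAr_le U T.
Proof.
rewrite OAr_leN /OAr_meet opprK OAr_join_lub.
by rewrite (OAr_leN U S) (OAr_leN U T).
Qed.

HB.instance Definition _ := isVectorLattice.Build R OA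
  OAr_le_refl OAr_le_anti OAr_le_trans OAr_le_add2r OAr_scale_ge0
  OAr_join_lub OAr_meet_glb.

End OArStructure.
End RegularOperators.

Arguments OAr {R} E {F} dc.

Definition COAr (R : realType) (E : vectorLatticeType R) (F : banachLatticeType R)
    (dc : dedekind_complete F) : set (OAr E dc) :=
  [set T | C_compact T].
Arguments COAr {R} E {F} dc.

(* Main.v *)
From mathcomp Require Import all_boot all_order all_algebra.
From mathcomp Require Import boolp classical_sets functions reals topology.
From mathcomp Require Import normedtype.
Require Import Defs.

Set Implicit Arguments.
Unset Strict Implicit.
Unset Printing Implicit Defensive.

Import Order.TTheory GRing.Theory Num.Theory.
Import numFieldNormedType.Exports.

Local Open Scope classical_set_scope.
Local Open Scope ring_scope.

(** Fix a point x. On the fragments of x a regular operator T behaves like an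
   order bounded, finitely additive F-valued measure, and C-compactness says
   that its range is totally bounded. The deviation of T from this property is
   measured inside F: gap x T is the set of widths e of the strips
   A <= T <= A + e, valid on all fragments of x, whose lower edge A has totally
   bounded range. Two strips can be replaced by one with lower edge the join of
   the two and width the meet of the two widths, so gap x T is directed
   downwards, and order continuity of the norm gives: if gap x T has no lower
   bound except those below 0, then T maps the fragments of x onto a totally
   bounded set (gap_totally_bounded). To prove a C-compactness result it
   therefore suffices to find strips whose widths have infimum 0; the calculus
   for this consists of gluing along a splitting x = y + (x - y) (gap_split)
   and of adding a C-compact operator and an error (gap_perturb).

   All the errors below come from an approximate Hahn decomposition. The
   positive part T^+ x is the supremum of T y over the fragments y of x, and
   T^- y + T^+ (x - y) = T^+ x - T y, so that the quantities
   T^- y + T^+ (x - y) have infimum 0 over y (vle_from_pos_neg).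
   - If T is C-compact, so is T^+: on y it is T up to T^- y, on x - y it is 0
     up to T^+ (x - y).
   - If |S| <= T with T positive and C-compact, then S is C-compact. On y the
     operator S is, up to the error S^- y, equal to T/2 + (S^+ - T/2), on x - y
     it is, up to the error S^+ (x - y), equal to - T/2 + (T/2 - S^-). Both
     remainders are dominated by T/2, and T/2 is C-compact; iterating k times,
     lower bounds of gap x S lie below 2^(1-k) T x (gap_halving), hence below 0.
   - Suprema of upward directed families of regular operators are computed
     pointwise, hence the C-compact operators are closed under suprema: an
     element T of the family is the lower edge of a strip for the supremum S,
     of width S x - T x.
   Thus the C-compact operators form a band. Directed suprema also show that
   the regular operators form a Dedekind complete vector lattice, and in such a
   lattice every band is a projection band. *)

(** * Bands of a Dedekind complete vector lattice *)

(** The Riesz decomposition theorem. For x >= 0 the component in B is the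
   supremum y of the elements of B below x: a positive part common to x - y and
   to an element of B could be added to y. *)
Lemma band_projection (R : realType) (L : vectorLatticeType R) (B : set L) :
  dedekind_complete L -> band B -> projection_band B.
Proof.
move=> dc bB; have [[[B0 BD BZ] Bid] Blub] := bB.
have pos_dec x : 0 <=v x ->
    exists y z, [/\ B y, disjoint_complement B z & x = y + z].
  move=> x0; pose D := [set b | B b /\ b <=v x].
  have D0 : D 0 by [].
  have [y lubD] : exists y, is_lub D y.
    by apply: dc; [exists 0|exists x => b []].
  have By : B y by apply: (Blub D) => // b [].
  have yx : y <=v x by apply: lubD.2 => b [].
  have z0 : 0 <=v x - y by exact/subv_ge0.
  exists y, (x - y); split; [by []| |by rewrite addrC subrK].
  move=> b Bb; rewrite /vdisjoint [vabs (x - y)]vabs_pos//.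
  set m := vmeet _ _; have m0 : 0 <=v m by apply: vmeet_ge => //; exact: vabs_ge0.
  have Bm : B m.
    by apply: (Bid _ b) => //; rewrite [vabs m]vabs_pos//; exact: vmeetr.
  apply: vle_anti => //.
  have /lubD.1 : D (m + y).
    by split; [exact: BD|apply/vle_subr; exact: vmeetl].
  by move/vle_subr; rewrite subrr.
have BN x : B x -> B (- x) by rewrite -scaleN1r; exact: BZ.
split=> //.
  apply/seteqP; split=> [x [Bx /(_ _ Bx)]|_ ->].
    rewrite /vdisjoint => h; have xx : vabs x <=v 0.
      by rewrite -h; apply: vmeet_ge; exact: vle_refl.
    apply: vle_anti; first exact: vle_trans (vle_abs x) xx.
    by have := vle_opp (vle_trans (vleN_abs x) xx); rewrite opprK oppr0.
  split=> // y _; exact/vdisjointC/vdisjoint0.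
move=> x; have [y [z [By Bz e]]] := pos_dec _ (vpos_ge0 x).
have [y' [z' [By' Bz' e']]] := pos_dec _ (vpos_ge0 (- x)).
exists (y - y'), (z - z'); split.
- by apply: BD => //; exact: BN.
- move=> b Bb; apply: vdisjointD; first exact: Bz.
  by have := Bz' _ Bb; rewrite /vdisjoint vabsN.
by rewrite {1}[x]vposE e e' opprD addrACA.
Qed.

(** * Suprema of regular operators *)

Section OArComplete.
Variables (R : realType) (E F : vectorLatticeType R) (dc : dedekind_complete F).
Notation OA := (OAr E dc).
Implicit Types (x y : E) (S T U : OA) (D : set OA).

Lemma OAr_vleP S T : S <=v T <-> forall x, S x <=v T x.
Proof. exact: OAr_leP. Qed.

(** Directedness is what makes the pointwise supremum orthogonally additive:
   for disjoint x and y, the sum S x + T y is bounded by U x + U y = U (x + y)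
   for any U above S and T. *)
Lemma OAr_directed_lub D : D !=set0 ->
  (forall S T, D S -> D T -> exists2 U, D U & S <=v U /\ T <=v U) ->
  (exists U, is_ub D U) ->
  exists s, is_lub D s /\ forall x, is_lub ((fun T : OA => T x) @` D) (s x).
Proof.
move=> [S0 DS0] dirD [U ubU].
have /choice [p lubp] x : exists s, is_lub ((fun T : OA => T x) @` D) s.
  apply: dc; first by exists (S0 x), S0.
  by exists (U x) => _ [T /ubU /OAr_vleP h <-]; exact: h.
have pge T x : D T -> T x <=v p x by move=> DT; apply: (lubp x).1; exists T.
have ple x u : (forall T, D T -> T x <=v u) -> p x <=v u.
  by move=> h; apply: (lubp x).2 => _ [T DT <-]; exact: h.
have padd : orthogonally_additive p.
  move=> x y xy; apply: vle_anti.
    by apply: (ple) => T DT; rewrite OAr_additive//; apply: vle_add; exact: pge.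
  apply/vle_subr; apply: (ple) => S DS; apply/vle_subr; rewrite addrC.
  apply/vle_subr; apply: (ple) => T DT; apply/vle_subr; rewrite addrC.
  have [V DV [/OAr_vleP SV /OAr_vleP TV]] := dirD _ _ DS DT.
  apply: vle_trans (pge V _ DV); rewrite OAr_additive//.
  exact: vle_add.
(* Above a member S0 of D, p differs from S0 by a positive operator. *)
have preg : regular_oao p.
  have -> : p = (S0 : E -> F) + (p - (S0 : E -> F)) by rewrite addrC subrK.
  apply: regular_oaoD; first exact: OAr_regular.
  apply: positive_regular; split=> [x y xy|x].
    by rewrite !fctE padd// OAr_additive// opprD addrACA.
  exact/subv_ge0/pge.
exists (MkOAr dc (asboolT preg)); split=> //; split.
  by move=> T DT; apply/OAr_vleP => x; exact: pge.
by move=> V ubV; apply/OAr_vleP => x; apply: (ple) => T /ubV /OAr_vleP.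
Qed.

(** The elements below all upper bounds of A are closed under joins, hence
   directed, and they have the same upper bounds as A. *)
Lemma OAr_dedekind_complete : dedekind_complete OA.
Proof.
move=> A [S AS] [U ubU].
pose D := [set T : OA | forall V, is_ub A V -> T <=v V].
have AD T : A T -> D T by move=> AT V; apply.
have [||| s [[ubs lubs] _]] := @OAr_directed_lub D.
- by exists S; exact: AD.
- move=> T T' DT DT'; exists (vjoin T T').
    by move=> V ubV; apply: vjoin_le; [exact: DT|exact: DT'].
  by split; [exact: vjoinl|exact: vjoinr].
- by exists U => T; apply.
by exists s; split=> [T /AD /ubs //|V ubV]; apply: lubs => T; apply.
Qed.

End OArComplete.

(** * Total boundedness *)

Definition totally_bounded (R : realType) (V : normedModType R) (X : set V) :=
  forall e : R, 0 < e ->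
    exists s : seq V, forall v, X v -> exists2 w, w \in s & `|v - w| < e.

Section TotallyBounded.
Variable R : realType.

Lemma precompact_totally_bounded (V : normedModType R) (X : set V) :
  precompact X -> totally_bounded X.
Proof.
rewrite precompactE compact_cover => cX e e0.
have [||D _ XD] := cX V setT (fun w => ball w e).
- by move=> w _; apply: ball_open.
- by move=> v _; exists v => //; exact: ballxx.
exists (finmap.enum_fset D) => v /subset_closure /XD [w /= wD wv].
by exists w => //; move: wv; rewrite -ball_normE /= distrC.
Qed.

(** Ultrafilters are prime: a member of G covered by finitely many sets has one
   of these sets in G. *)
Lemma ultra_seq_cover (T : choiceType) (G : set_system T) (I : eqType)
    (s : seq I) (B : I -> set T) (A : set T) : UltraFilter G -> G A ->
  (forall v, A v -> exists2 w, w \in s & B w v) -> exists w, G (B w).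
Proof.
move=> UG; elim: s A => [|w s ih] A GA cov.
  have A0 : A `<=` set0 by move=> v /cov [].
  by case: (@filter_not_empty _ G _); apply: filterS GA.
have [|GnB] := in_ultra_setVsetC (B w) UG; first by exists w.
apply: (ih _ (filterI GA GnB)) => v [/cov [u]].
by rewrite inE => /orP[/eqP ->|us] // Bv _; exists u.
Qed.

(** An ultrafilter on the closure contains a ball of every radius, so it is
   Cauchy and converges by completeness. *)
Lemma totally_bounded_precompact (V : completeNormedModType R) (X : set V) :
  totally_bounded X -> precompact X.
Proof.
move=> tX; rewrite precompactE compact_ultra => G UG GX.
have cG : cauchy_ex G.
  move=> e e0; have [s hs] := tX _ (divr_gt0 e0 (ltr0n R 2)).
  apply: (ultra_seq_cover (s := s) (B := fun w => ball w e) UG GX) => v.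
  move=> /(_ (ball v (e / 2)) (nbhsx_ballx v _ (divr_gt0 e0 (ltr0n R 2)))).
  move=> [u [/hs [w ws uw] vu]]; exists w => //.
  have vu' : `|v - u| < e / 2 by move: vu; rewrite -ball_normE.
  suff : `|w - v| < e by rewrite -ball_normE.
  have -> : w - v = (w - u) + (u - v) by rewrite addrA subrK.
  rewrite [e]splitr; apply: le_lt_trans (ler_normD _ _) _.
  by rewrite ltrD// distrC.
have /cauchy_cvgP Gl : cauchy G by exact: cauchy_exP.
exists (lim G); split => //.
apply: closed_closure => B /Gl GB; exact: filter_ex (filterI GX GB).
Qed.

End TotallyBounded.
Section NormLattice.
Variables (R : realType) (F : banachLatticeType R).
Implicit Types (a b u v : F) (X Y Z : set F).

Lemma norm_vabs u : `|vabs u| = `|u|.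
Proof.
have e : vabs (vabs u) = vabs u by rewrite [LHS]vabs_pos//; exact: vabs_ge0.
by apply/eqP; rewrite eq_le !lattice_norm// e; exact: vle_refl.
Qed.

(** The join is nonexpansive in each argument, so that it preserves total
   boundedness. *)
Lemma vjoin_sub_le a b a' b' :
  vjoin a b - vjoin a' b' <=v vabs (a - a') + vabs (b - b').
Proof.
apply/vle_subl; apply: vjoin_le.
  rewrite -[X in X <=v _](subrK a'); apply: vle_add; last exact: vjoinl.
  by apply: vle_trans (vle_abs _) _; apply: vle_addl; exact: vabs_ge0.
rewrite -[X in X <=v _](subrK b'); apply: vle_add; last exact: vjoinr.
apply: vle_trans (vle_abs _) _; rewrite [X in _ <=v X]addrC; apply: vle_addl.
exact: vabs_ge0.
Qed.

Lemma norm_vjoin_sub a b a' b' :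
  `|vjoin a b - vjoin a' b'| <= `|a - a'| + `|b - b'|.
Proof.
apply: (@le_trans _ _ `|vabs (a - a') + vabs (b - b')|); last first.
  by apply: le_trans (ler_normD _ _) _; rewrite !norm_vabs.
apply: lattice_norm; rewrite [X in _ <=v X]vabs_pos; last first.
  by apply: addv_ge0; exact: vabs_ge0.
apply: vabs_le; first exact: vjoin_sub_le.
rewrite opprB -[a - a']opprB -[b - b']opprB !vabsN.
exact: vjoin_sub_le.
Qed.

Lemma totally_bounded2 (op : F -> F -> F) X Y Z :
  (forall a b a' b', `|op a b - op a' b'| <= `|a - a'| + `|b - b'|) ->
  (forall v, Z v -> exists a b, [/\ X a, Y b & v = op a b]) ->
  totally_bounded X -> totally_bounded Y -> totally_bounded Z.
Proof.
move=> lip ZE tX tY e e0; have e2 : 0 < e / 2 by rewrite divr_gt0.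
have [s hs] := tX _ e2; have [t ht] := tY _ e2.
exists [seq op a b | a <- s, b <- t] => v /ZE [a [b [Xa Yb ->]]].
have [a' sa' aa'] := hs _ Xa; have [b' tb' bb'] := ht _ Yb.
exists (op a' b'); first exact: allpairs_f.
apply: le_lt_trans (lip _ _ _ _) _; rewrite [e]splitr; exact: ltrD.
Qed.

Lemma norm_add_sub a b a' b' :
  `|(a + b) - (a' + b')| <= `|a - a'| + `|b - b'|.
Proof. by rewrite opprD addrACA; exact: ler_normD. Qed.

Lemma totally_bounded_sub X Y : X `<=` Y -> totally_bounded Y -> totally_bounded X.
Proof.
by move=> XY tY e /tY [s hs]; exists s => v /XY; exact: hs.
Qed.

Lemma totally_bounded1 u : totally_bounded [set u].
Proof.
move=> e e0; exists [:: u] => _ ->.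
by exists u; rewrite ?inE// subrr normr0.
Qed.

Lemma totally_boundedZ (c : R) X :
  totally_bounded X -> totally_bounded ((fun u => c *: u) @` X).
Proof.
move=> tX e e0; have c0 : 0 < `|c| + 1 by rewrite ltr_wpDl.
have [s hs] := tX _ (divr_gt0 e0 c0).
exists [seq c *: u | u <- s] => _ [u /hs [w ws uw] <-].
exists (c *: w); first exact: map_f.
rewrite -scalerBr normrZ; apply: (@le_lt_trans _ _ ((`|c| + 1) * `|u - w|)).
  by rewrite ler_wpM2r// lerDl.
by rewrite mulrC -ltr_pdivlMr.
Qed.

End NormLattice.

(** * Strips with totally bounded lower edge *)

Section Gap.
Variables (R : realType) (E : vectorLatticeType R) (F : banachLatticeType R).
Implicit Types (x y z : E) (T S K : E -> F) (e u v w : F).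

(** The infimum of gap x T plays the part of an F-valued measure of
   noncompactness of T on the fragments of x. *)
Definition gap x T : set F := [set e | exists A : E -> F,
  totally_bounded (A @` fragments x) /\
  forall z, fragments x z -> A z <=v T z /\ T z <=v A z + e].

(** T lies above both lower edges A and A', hence above their join, and
   T - (A v A') is the meet of T - A and T - A'. *)
Lemma gap_meet x T e e' : gap x T e -> gap x T e' -> gap x T (vmeet e e').
Proof.
move=> [A [tA hA]] [A' [tA' hA']]; exists (fun z => vjoin (A z) (A' z)); split.
  apply: (totally_bounded2 (@norm_vjoin_sub _ _) _ tA tA') => _ [z xz <-].
  by exists (A z), (A' z).
move=> z xz; have [a1 a2] := hA _ xz; have [b1 b2] := hA' _ xz.
split; first exact: vjoin_le.
rewrite addrC; apply/vle_subl; apply: vmeet_ge; apply/vle_subl; rewrite addrC.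
  by apply: vle_trans a2 _; apply: vle_add2r; exact: vjoinl.
by apply: vle_trans b2 _; apply: vle_add2r; exact: vjoinr.
Qed.

Lemma fragments_trans x y z : fragments x y -> fragments y z -> fragments x z.
Proof.
move=> xy yz; have [_] := fragmentsD xy yz (fragments0 (x - y)).
by rewrite addr0 addrC subrK.
Qed.

(** Every fragment of x splits into a fragment of y and one of x - y,
   and the lower edges on y and on x - y are added along this splitting. *)
Lemma gap_split x y T e e' : orthogonally_additive T -> fragments x y ->
  gap y T e -> gap (x - y) T e' -> gap x T (e + e').
Proof.
move=> aT xy [A [tA hA]] [A' [tA' hA']].
have split z : exists p : E * E, fragments x z ->
    [/\ fragments y p.1, fragments (x - y) p.2 & z = p.1 + p.2].
  have [xz|nxz] := pselect (fragments x z); last by exists (0, 0).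
  have := xz; rewrite -{1}[x](subrK y) addrC => /(fragments_add xy).
  by move=> [z1 [z2 h]]; exists (z1, z2).
have [p hp] := choice split.
exists (fun z => A (p z).1 + A' (p z).2); split.
  apply: (totally_bounded2 (@norm_add_sub _ _) _ tA tA') => _ [z xz <-].
  have [p1 p2 _] := hp _ xz; exists (A (p z).1), (A' (p z).2).
  by [].
move=> z xz; have [p1 p2 ze] := hp _ xz.
have [d _] := fragmentsD xy p1 p2.
have -> : T z = T (p z).1 + T (p z).2 by rewrite {1}ze aT.
have [a1 a2] := hA _ p1; have [b1 b2] := hA' _ p2.
by split; [exact: vle_add|rewrite addrACA; exact: vle_add].
Qed.

(** If S differs from T + K by an error between - v and u, a strip for T gives
   one for S with lower edge shifted by K - v. *)
Lemma gap_perturb x T K S e u v : totally_bounded (K @` fragments x) ->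
  (forall z, fragments x z -> T z + K z - v <=v S z /\ S z <=v T z + K z + u) ->
  gap x T e -> gap x S (e + u + v).
Proof.
move=> tK hS [A [tA hA]]; exists (fun z => A z + K z - v); split.
  apply: (totally_bounded2 (X := (fun z => A z + K z) @` fragments x)
    (@norm_add_sub _ _) _ _ (@totally_bounded1 _ _ (- v))).
    by move=> _ [z xz <-]; exists (A z + K z), (- v); split=> //; exists z.
  apply: (totally_bounded2 (@norm_add_sub _ _) _ tA tK) => _ [z xz <-].
  by exists (A z), (K z).
move=> z xz; have [a1 a2] := hA _ xz; have [s1 s2] := hS _ xz; split.
  by apply: vle_trans s1; apply: vle_add2r; exact: vle_add2r.
apply: vle_trans s2 _.
have -> : A z + K z - v + (e + u + v) = A z + e + K z + u.
  by rewrite addrA addrAC subrK addrA [A z + K z + e]addrAC.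
by apply: vle_add2r; exact: vle_add2r.
Qed.

(** By order continuity, the widths, which are directed downwards to 0, have
   arbitrarily small norm; a finite net for the lower edge of a narrow strip is
   then one for T. *)
Lemma gap_totally_bounded x T : order_continuous_norm F ->
  gap x T !=set0 -> (forall w, is_lb (gap x T) w -> w <=v 0) ->
  totally_bounded (T @` fragments x).
Proof.
move=> oc [e0 ge0] lb0.
have glb0 : is_glb (gap x T) 0.
  split=> // e [A [_ /(_ 0 (fragments0 x)) [a1 a2]]].
  by move: (vle_trans a1 a2); rewrite [X in _ <=v X]addrC => /vle_subl; rewrite subrr.
pose le (i j : {e | gap x T e}) := sval j <=v sval i.
have dir : directed le.
  split; [by split; exists e0|by move=> i; exact: vle_refl| |].
    by move=> j i k ij jk; exact: vle_trans jk ij.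
  move=> [e he] [e' he']; exists (exist _ _ (gap_meet he he')).
  by split; [exact: vmeetl|exact: vmeetr].
have glb : is_glb (range (fun i : {e | gap x T e} => sval i)) 0.
  split=> [_ [[e he] _ <-]|w hw]; first exact: glb0.1.
  by apply: glb0.2 => e he; apply: hw; exists (exist _ e he).
have [_ [_ inf0]] := oc _ le (fun i => sval i) dir (fun i j h => h) glb.
move=> r r0; have r2 : 0 < r / 2 by rewrite divr_gt0.
have [[e [A [tA hA]]] /= er] : exists i : {e | gap x T e}, `|sval i| < r / 2.
  apply: contrapT => hN; suff : r / 2 <= 0 by rewrite leNgt r2.
  apply: inf0 => _ [i _ <-]; rewrite leNgt; apply/negP => hi.
  by apply: hN; exists i.
have [s hs] := tA _ r2; exists s => _ [z xz <-].
have [w ws Aw] := hs (A z) (imageP _ xz); exists w => //.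
have -> : T z - w = (T z - A z) + (A z - w) by rewrite addrA subrK.
apply: le_lt_trans (ler_normD _ _) _; rewrite [r]splitr; apply: ltrD => //.
apply: le_lt_trans er; have [a1 a2] := hA _ xz.
by apply: norm_le_pos; [exact/subv_ge0|apply/vle_subl; rewrite addrC].
Qed.

End Gap.
(** * Compactness of positive parts, and domination *)

Section Compactness.
Variables (R : realType) (E : vectorLatticeType R) (F : banachLatticeType R).
Variable oc : order_continuous_norm F.
Notation dc := (order_continuous_dedekind oc).
Notation OA := (OAr E dc).
Implicit Types (x y z : E) (S T K : OA) (e u v w : F).

Lemma COAr_totally_bounded T :
  COAr E dc T <-> forall x, totally_bounded (T @` fragments x).
Proof.
split=> h x; first exact/precompact_totally_bounded/h.
exact/totally_bounded_precompact/h.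
Qed.

Lemma positive_fragment_le (P : E -> F) x y :
  positive_oao P -> fragments x y -> P y <=v P x.
Proof.
move=> [aP pP] xy; have -> : P x = P y + P (x - y).
  by rewrite -aP// addrC subrK.
exact: vle_addl.
Qed.

Lemma fragment_additive T x y : fragments x y -> T x = T y + T (x - y).
Proof. by move=> xy; rewrite -(OAr_additive T xy) addrC subrK. Qed.

Definition neg_part T : OA := pos_part T - T.

Lemma neg_partE T x : neg_part T x = pos_part T x - T x.
Proof. by []. Qed.

Lemma neg_part_positive T : positive_oao (neg_part T).
Proof.
split=> [|x]; first exact: OAr_additive.
by apply/(subv_ge0 (T x) (pos_part T x)); apply: pos_part_ub; exact: fragments_self.
Qed.

Lemma pos_neg_fragment T x y : fragments x y ->
  neg_part T y + pos_part T (x - y) = pos_part T x - T y.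
Proof.
by move=> xy; rewrite neg_partE (fragment_additive (pos_part T) xy) addrAC.
Qed.

(** Approximate Hahn decomposition: T^- y + T^+ (x - y) = T^+ x - T y has
   infimum 0 over the fragments y of x, since T^+ x is the supremum of T y. *)
Lemma vle_from_pos_neg T x u w :
  (forall y, fragments x y ->
    w <=v u + (neg_part T y + pos_part T (x - y))) -> w <=v u.
Proof.
move=> h; suff : pos_part T x <=v u + pos_part T x - w.
  move=> /vle_subr; rewrite [X in X <=v _]addrC => /vle_subr.
  by rewrite addrK.
apply: pos_part_least => y xy; apply/vle_subr; rewrite addrC; apply/vle_subr.
by rewrite -addrA -pos_neg_fragment//; exact: h.
Qed.

(** On a fragment y that nearly attains T^+ x, the operator T^+ is close to T;
   on x - y it is close to 0. *)
Lemma pos_part_compact T : COAr E dc T -> COAr E dc (pos_part T).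
Proof.
move=> /COAr_totally_bounded cT; apply/COAr_totally_bounded => x.
have g y : fragments x y ->
    gap x (pos_part T) (neg_part T y + pos_part T (x - y)).
  move=> xy; apply: (gap_split (OAr_additive _) xy).
    exists T; split=> // z yz; split; first exact/pos_part_ub/fragments_self.
    rewrite addrC; apply/vle_subl; rewrite -neg_partE.
    exact: (positive_fragment_le (neg_part_positive T) yz).
  exists (fun _ => 0); split.
    by apply: totally_bounded_sub (totally_bounded1 0) => _ [_ _ <-].
  move=> z yz; split; first exact: (pos_part_positive T).2.
  by rewrite add0r; exact: positive_fragment_le (pos_part_positive T) yz.
apply: gap_totally_bounded => // [|w lw].
  by eexists; exact/g/fragments0.
by apply: (@vle_from_pos_neg T x) => y xy; rewrite add0r; exact/lw/g.
Qed.

Lemma dominated_pos_part T S x : positive_oao T ->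
  (forall z, S z <=v T z) -> pos_part S x <=v T x.
Proof.
move=> pT ST; apply: pos_part_least => y xy.
exact: vle_trans (ST y) (positive_fragment_le pT xy).
Qed.

(** Since S^- x is the supremum of S y - S x = - S (x - y) over the fragments y,
   only values of - S enter. *)
Lemma dominated_neg_part T S x : positive_oao T ->
  (forall z, - S z <=v T z) -> neg_part S x <=v T x.
Proof.
move=> pT ST; rewrite neg_partE; apply/vle_subl; apply: pos_part_least => y xy.
rewrite (fragment_additive S xy) [S y + _]addrC addrA -[X in X <=v _]add0r.
apply: vle_add2r; rewrite -[X in _ + X]opprK; apply/subv_ge0.
exact: vle_trans (ST _) (positive_fragment_le pT (fragmentsC xy)).
Qed.

Lemma scaled_half T x : T x = ((2^-1 : R) *: T : OA) x + ((2^-1 : R) *: T : OA) x.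
Proof.
change (T x = (2^-1 : R) *: T x + (2^-1 : R) *: T x).
by rewrite -scalerDl -[2^-1]mul1r -splitr scale1r.
Qed.

Lemma COAr_scale (a : R) T : COAr E dc T -> COAr E dc (a *: T).
Proof.
move=> /COAr_totally_bounded cT; apply/COAr_totally_bounded => x.
apply: totally_bounded_sub (totally_boundedZ a (cT x)) => _ [z xz <-].
by exists (T z) => //; exists z.
Qed.

Lemma COAr_add S T : COAr E dc S -> COAr E dc T -> COAr E dc (S + T).
Proof.
move=> /COAr_totally_bounded cS /COAr_totally_bounded cT.
apply/COAr_totally_bounded => x.
apply: (totally_bounded2 (@norm_add_sub _ _) _ (cS x) (cT x)) => _ [z xz <-].
by exists (S z), (T z); split=> //; exists z.
Qed.

Lemma COAr_opp T : COAr E dc T -> COAr E dc (- T).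
Proof. by rewrite -scaleN1r; exact: COAr_scale. Qed.

Lemma vle_half_shift u v : 0 <=v u -> u <=v v + v ->
  - v <=v u - v /\ u - v <=v v.
Proof.
move=> u0 uv; split; last exact/vle_subl.
by rewrite -[X in X <=v _]add0r; exact: vle_add2r.
Qed.

(** The constant lower edge - T x serves all fragments of x. *)
Lemma gap_dominated T S x : positive_oao T ->
  (forall z, - T z <=v S z /\ S z <=v T z) -> gap x S ((2 : R) *: T x).
Proof.
move=> pT ST; exists (fun _ => - T x); split.
  by apply: totally_bounded_sub (totally_bounded1 (- T x)) => _ [_ _ <-].
move=> z xz; have [s1 s2] := ST z; have Tzx := positive_fragment_le pT xz.
split; first exact: vle_trans (vle_opp Tzx) s1.
by rewrite scaler_nat mulr2n addrA addNr add0r; exact: vle_trans s2 Tzx.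
Qed.

(** Splitting x into y and x - y and correcting S by T/2 on y and by - T/2 on
   x - y leaves the remainders S^+ - T/2 and T/2 - S^-, dominated by T/2, at
   the cost of the error S^- y + S^+ (x - y), which has infimum 0. The
   correction does not change the gap because T is C-compact. The induction
   runs over all S and T, since the remainders depend on y. *)
Lemma gap_halving k T S x w : positive_oao T -> COAr E dc T ->
  (forall z, - T z <=v S z /\ S z <=v T z) ->
  is_lb (gap x S) w -> w <=v ((2 : R) / 2 ^+ k) *: T x.
Proof.
elim: k T S x w => [|k ih] T S x w pT cT ST lw.
  by rewrite expr0 divr1; apply: lw; exact: gap_dominated.
pose H : OA := (2^-1 : R) *: T.
have h0 : 0 <= (2^-1 : R) by rewrite invr_ge0.
have pH : positive_oao H by exact: positive_oaoZ.
have cH : COAr E dc H by exact: COAr_scale.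
have HE z : T z = H z + H z by exact: scaled_half.
have Sp z : pos_part S z <=v H z + H z.
  by rewrite -HE; apply: dominated_pos_part => // t; case: (ST t).
have Sn z : neg_part S z <=v H z + H z.
  rewrite -HE; apply: dominated_neg_part => // t; have [h _] := ST t.
  by rewrite -[T t]opprK; exact: vle_opp.
have SE z : S z = pos_part S z - neg_part S z by rewrite neg_partE subKr.
pose c : R := 2 / 2 ^+ k.
have cE z : (2 / 2 ^+ k.+1) *: T z = c *: H z.
  by rewrite /H /= scalerA /c exprSr invfM mulrA.
rewrite cE; apply: (@vle_from_pos_neg S x) => y xy.
have xy' := fragmentsC xy.
have g1 e : gap y (pos_part S - H) e -> gap y S (e + neg_part S y).
  move=> ge; rewrite -[e]addr0; move: ge; apply: (@gap_perturb _ _ _ _ _ H).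
    exact: (COAr_totally_bounded H).1.
  move=> z yz.
  have -> : (pos_part S - H : OA) z + H z = pos_part S z by exact: subrK.
  rewrite SE addr0; split.
    apply: vle_add; first exact: vle_refl.
    exact/vle_opp/(positive_fragment_le (neg_part_positive S)).
  by apply/vle_subl/vle_addl; exact: (neg_part_positive S).2.
have g2 e : gap (x - y) (H - neg_part S) e -> gap (x - y) S (e + pos_part S (x - y)).
  move=> ge; rewrite -[e + _]addr0; move: ge; apply: (@gap_perturb _ _ _ _ _ (- H)).
    exact: (COAr_totally_bounded (- H)).1 (COAr_opp cH) _.
  move=> z yz.
  have -> : (H - neg_part S : OA) z + (- H : OA) z = - neg_part S z.
    change (H z - neg_part S z - H z = - neg_part S z).
    by rewrite addrAC subrr add0r.
  rewrite SE subr0 [- _ + _]addrC; split.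
    rewrite -[X in X <=v _]add0r; apply: vle_add2r.
    exact: (pos_part_positive S).2.
  apply: vle_add2r; exact: positive_fragment_le (pos_part_positive S) yz.
(* The width e1 on y is kept fixed while the one on x - y is bounded, then the
   roles are exchanged. *)
have b1 : w - (neg_part S y + pos_part S (x - y)) - c *: H (x - y) <=v c *: H y.
  apply: (ih H (pos_part S - H)) => // [z|e1 ge1].
    exact: vle_half_shift ((pos_part_positive S).2 z) (Sp z).
  apply: (vle_subl _ _ _).2; rewrite [X in _ <=v X]addrC.
  apply: (vle_subl _ _ _).1.
  apply: (ih H (H - neg_part S)) => // [z|e2 ge2].
    have [a1 a2] := vle_half_shift ((neg_part_positive S).2 z) (Sn z).
    change (- H z <=v H z - neg_part S z /\ H z - neg_part S z <=v H z).
    split; first by move/vle_opp: a2; rewrite opprB.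
    by move/vle_opp: a1; rewrite opprB opprK.
  have := lw _ (gap_split (OAr_additive S) xy (g1 _ ge1) (g2 _ ge2)).
  rewrite addrACA => h; apply/vle_subl; apply/vle_subl.
  by rewrite [e2 + e1]addrC.
move/vle_subl: b1 => /vle_subl.
by rewrite -scalerDr -(fragment_additive H xy).
Qed.

Lemma vle0_geometric w u : 0 <=v u -> 
  (forall k : nat, w <=v ((2 : R) / 2 ^+ k) *: u) -> w <=v 0.
Proof.
move=> u0 h; suff -> : 0 = vpos w by exact: vpos_ge.
apply/esym/(@banach_arch _ _ _ ((2 : R) *: u)); first exact: vpos_ge0.
move=> n.
have h1 : vpos w <=v ((2 : R) / 2 ^+ n) *: u.
  by apply: vpos_le => //; apply: scalev_ge0 => //; rewrite divr_ge0// exprn_ge0.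
have h2 : 0 <=v (2 ^+ n : R) *: (((2 : R) / 2 ^+ n) *: u - vpos w).
  by apply: scalev_ge0; [rewrite exprn_ge0|exact/subv_ge0].
apply: (@vle_trans _ _ ((2 ^+ n : R) *: vpos w)).
  rewrite -scaler_nat; apply/subv_ge0; rewrite -scalerBl; apply: scalev_ge0.
    by rewrite subr_ge0 -natrX ler_nat ltnW// ltn_expl.
  exact: vpos_ge0.
apply/subv_ge0; move: h2; rewrite scalerBr scalerA mulrCA mulfV ?mulr1//.
by rewrite expf_neq0 ?pnatr_eq0.
Qed.

(** The bounds of gap_halving tend to 0 as k grows, and F is Archimedean. *)
Lemma dominated_compact T S : positive_oao T -> COAr E dc T ->
  (forall z, - T z <=v S z /\ S z <=v T z) -> COAr E dc S.
Proof.
move=> pT cT ST; apply/COAr_totally_bounded => x; apply: gap_totally_bounded => //.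
  by exists ((2 : R) *: T x); exact: gap_dominated.
move=> w lw; apply: (@vle0_geometric _ (T x)); first exact: pT.2.
by move=> k; exact: gap_halving lw.
Qed.

(** * The band of C-compact operators *)

Lemma COAr_subspace : linear_subspace (COAr E dc).
Proof.
split=> [||a T]; [|exact: COAr_add|exact: COAr_scale].
apply/COAr_totally_bounded => x.
by apply: totally_bounded_sub (totally_bounded1 0) => _ [z _ <-].
Qed.

Lemma COAr_join S T : COAr E dc S -> COAr E dc T -> COAr E dc (vjoin S T).
Proof.
move=> cS cT; apply: COAr_add => //; apply: pos_part_compact.
by apply: COAr_add => //; exact: COAr_opp.
Qed.

Lemma COAr_ideal : ideal (COAr E dc).
Proof.
split=> [|S T /OAr_vleP ST cT]; first exact: COAr_subspace.
apply: (@dominated_compact (vabs T)).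
- split; first exact: OAr_additive.
  by move: (vabs_ge0 T) => /OAr_vleP.
- by apply: COAr_join => //; exact: COAr_opp.
move=> z; have /OAr_vleP Sp := vle_abs S; have /OAr_vleP Sn := vleN_abs S.
split; last exact: vle_trans (Sp z) (ST z).
rewrite -[S z]opprK; apply: vle_opp; exact: vle_trans (Sn z) (ST z).
Qed.

(** Each T in D is the lower edge of a strip for S, of width S x - T x, and
   these widths have infimum 0. *)
Lemma COAr_pointwise_lub D S : D `<=` COAr E dc -> D !=set0 ->
  (forall T, D T -> T <=v S) ->
  (forall x, is_lub ((fun T : OA => T x) @` D) (S x)) -> COAr E dc S.
Proof.
move=> DC [T0 DT0] DS lubS; apply/COAr_totally_bounded => x.
have g T : D T -> gap x S (S x - T x).
  move=> DT; exists T; split; first exact/(COAr_totally_bounded T).1/DC.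
  have TS := DS _ DT.
  have pST : positive_oao (S - T : OA) by exact: TS.
  move=> z xz; split; first by have /OAr_vleP := TS; exact.
  rewrite addrC; apply/vle_subl; exact: positive_fragment_le pST xz.
apply: gap_totally_bounded => // [|w lw]; first by eexists; exact: g DT0.
suff : S x <=v S x - w.
  by move=> /vle_subr; rewrite [X in X <=v _]addrC => /vle_subr; rewrite subrr.
apply: (lubS x).2 => _ [T DT <-]; apply/vle_subr.
by rewrite addrC; apply/vle_subr; exact/lw/g.
Qed.

(** The supremum S of A is also that of the C-compact operators below S, a
   family which is directed because C-compactness is stable under joins. *)
Lemma COAr_band : band (COAr E dc).
Proof.
split=> [|A S AC lubS]; first exact: COAr_ideal.
(* A least upper bound of the empty set lies below every operator, so is 0. *)
have [[T0 AT0]|/nonemptyPn A0] := pselect (A !=set0); last first.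
  have Slow U : S <=v U by apply: lubS.2 => T; rewrite A0.
  have -> : S = 0; last by have [] := COAr_subspace.
  apply: vle_anti; first exact: Slow.
  by rewrite -[X in X <=v _](subrr S); apply/vle_subl; exact: Slow.
pose D := [set T | COAr E dc T /\ T <=v S].
have AD T : A T -> D T by move=> AT; split; [exact: AC|exact: lubS.1].
have [||| S' [lubS' ptS']] := @OAr_directed_lub _ _ _ dc D.
- by exists T0; exact: AD.
- move=> T T' [cT TS] [cT' T'S]; exists (vjoin T T').
    by split; [exact: COAr_join|exact: vjoin_le].
  by split; [exact: vjoinl|exact: vjoinr].
- by exists S => T [].
have SS' : S = S'.
  apply: vle_anti; first by apply: lubS.2 => T /AD; exact: lubS'.1.
  by apply: lubS'.2 => T [].
apply: (@COAr_pointwise_lub D) => [T []//||T []//|]; first by exists T0; exact: AD.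
by rewrite SS'.
Qed.

End Compactness.

Theorem theorem3p9 (R : realType) (E : vectorLatticeType R)
    (F : banachLatticeType R) (arE : archimedean E)
    (ocF : order_continuous_norm F) :
  projection_band (COAr E (order_continuous_dedekind ocF)).
Proof.
apply: band_projection; first exact: OAr_dedekind_complete.
exact: COAr_band.
Qed.
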